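(* Let $u^+,u^-:\mathbb{R}\to[0,\infty)$ be continuous with $u^+(x)=0$ for $x\le0$, $u^+$ increasing on $[0,\infty)$, $u^-(x)=0$ for $x\ge0$, and $u^-$ decreasing on $(-\infty,0]$. Suppose $u^+$ is differentiable on $(0,\infty)$ with $k^+\le|(u^+)'|\le K^+$ there, and $u^-$ is differentiable on $(-\infty,0)$ with $k^-\le|(u^-)'|\le K^-$ there, where $K^+,k^+,K^-,k^->0$. Let $w^+,w^-:[0,1]\to[0,1]$ be continuous and non-decreasing with $w^\pm(0)=0$ and $w^\pm(1)=1$, and suppose both are Hölder continuous with exponent $\alpha\in(0,1]$ and constant $L>0$, i.e. $|w^\pm(p)-w^\pm(q)|\le L|p-q|^\alpha$ for all $p,q\in[0,1]$. Let $F,G$ be CDFs on $\mathbb{R}$ (with $C(F)$ well defined and finite). Then, for every $\tau>0$, $$|C(F)-C(G|_\tau)|\le L(K^++K^-)[W_1(F,G)]^\alpha\tau^{1-\alpha}+LK^+\int_{\frac{k^+}{K^+}\tau}^\infty[1-F(z)]^\alpha\,dz+LK^-\int_{-\infty}^{-\frac{k^-}{K^-}\tau}[F(z)]^\alpha\,dz.$$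
   Context: For a random variable $X$ with CDF $F$, the CPT-value is $$C(F)=C(X)=\int_0^\infty w^+\left(\mathbb{P}(u^+(X)>z)\right)dz-\int_0^\infty w^-\left(\mathbb{P}(u^-(X)>z)\right)dz.$$ For a CDF $G$ and $\tau>0$, the truncated CDF $G|_\tau$ is given by $G|_\tau(x)=G(x)\mathbf 1\{-\tau\le x<\tau\}+\mathbf 1\{x\ge\tau\}$. $W_1$ is the 1-Wasserstein distance between CDFs on $\mathbb{R}$: $W_1(F_1,F_2)=\inf\int_{\mathbb{R}^2}|x-y|\,dF(x,y)$ over joint distributions $F$ with marginals $F_1,F_2$ (possibly $+\infty$); equivalently $W_1(F_1,F_2)=\int_{-\infty}^{\infty}|F_1(s)-F_2(s)|\,ds$. *)

(* Defs.v *)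
From HB Require Import structures.
From mathcomp Require Import all_boot all_order all_algebra.
From mathcomp Require Import all_classical all_reals all_analysis.

Set Implicit Arguments.
Unset Strict Implicit.
Unset Printing Implicit Defensive.

Import Order.TTheory GRing.Theory Num.Theory.
Import numFieldNormedType.Exports.

Local Open Scope classical_set_scope.
Local Open Scope ring_scope.

Notation cdfun R := (cumulativeBounded (0 : R) (1 : R)).

(* For nonnegative weights the difference is a finite number exactly when both
   integrals are finite: in [\bar R], [+oo - +oo = -oo]. *)
Definition cptX d (T : measurableType d) (R : realType) (P : probability T R)
    (up um wp wm : R -> R) (X : {RV P >-> R}) : \bar R :=
  (\int[lebesgue_measure]_(z in `[0%R, +oo[)
      (wp (fine (P [set t | z < up (X t)])))%:E
   - \int[lebesgue_measure]_(z in `[0%R, +oo[)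
      (wm (fine (P [set t | z < um (X t)])))%:E)%E.

Definition idR (R : realType) : measurableTypeR R -> R := idfun.

HB.instance Definition _ (R : realType) :=
  @isMeasurableFun.Build _ _ _ _ (@idR R) (@measurable_id _ _ setT).

(* The CPT-value of a distribution function: that of the identity random
   variable under the probability with distribution function [F].  By
   [cptX_cdf] below, for measurable utilities every random variable with this
   law has this value. *)
Definition cpt (R : realType) (up um wp wm : R -> R) (F : cdfun R) : \bar R :=
  cptX up um wp wm (@idR R : {RV (lebesgue_stieltjes_measure F) >-> R}).

(* For every cdf [G] and every [t] this is again a cdf: see the instances at
   the end of the file. *)
Definition trunc_cdf (R : realType) (t : R) (G : R -> R) (x : R) : R :=
  G x * \1_`[- t, t[ x + \1_`[t, +oo[ x.

(* [F] and [G] are the distribution functions of the two marginals of [g]. *)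
Definition coupling (R : realType) (F G : R -> R)
    (g : probability (R * R)%type R) : Prop :=
  forall x : R, g (`]-oo, x] `*` setT) = (F x)%:E /\
                g (setT `*` `]-oo, x]) = (G x)%:E.

Definition wasserstein1 (R : realType) (F G : R -> R) : \bar R :=
  ereal_inf [set (\int[g]_p (`|p.1 - p.2|)%:E)%E | g in coupling F G].

Section cptX_cdf.
Context d (T : measurableType d) (R : realType) (P : probability T R).
Variables (X : {RV P >-> R}) (F : cdfun R).
Hypothesis XF : forall r, cdf X r = (F r)%:E.

Let X' : T -> measurableTypeR R := X.

Let mX' : measurable_fun setT X'.
Proof. exact: measurable_funPT X. Qed.

#[local] HB.instance Definition _ := @isMeasurableFun.Build _ _ _ _ X' mX'.

Lemma lebesgue_stieltjes_distribution (A : set R) : measurable A ->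
  lebesgue_stieltjes_measure F A = distribution P X A.
Proof.
move=> mA; have -> : distribution P X A = distribution P X' A by [].
apply: lebesgue_stieltjes_measure_unique => [I [[a b]]/= _ <- | //].
rewrite /lebesgue_stieltjes_measure /measure_extension/=.
rewrite measurable_mu_extE/=; last exact: is_ocitv.
have [ab | ba] := leP a b; last first.
  by rewrite set_itv_ge ?wlength0 ?measure0// bnd_simp -leNgt ltW.
have -> : distribution P X' `]a, b] = distribution P X `]a, b] by [].
rewrite wlength_itv_bnd// EFinB -!XF /cdf.
have -> : `]a, b]%classic = `]-oo, b] `\` `]-oo, a].
  by rewrite -[RHS]setCK setCD setCitvl setUC -[LHS]setCK setCitv.
rewrite measureD ?setIidr//; first exact: subset_itvl.
by rewrite -ge0_fin_numE// fin_num_measure.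
Qed.

Lemma cptX_cdf (up um wp wm : R -> R) :
  measurable_fun setT up -> measurable_fun setT um ->
  cptX up um wp wm X = cpt up um wp wm F.
Proof.
move=> mup mum; rewrite /cpt /cptX.
have H (u : R -> R) (z : R) : measurable_fun setT u ->
    P [set t | z < u (X t)] =
    lebesgue_stieltjes_measure F [set t | z < u (idR t)].
  move=> mu; rewrite (lebesgue_stieltjes_distribution (A := [set t | z < u t])) //.
  rewrite (_ : [set t | _] = u @^-1` `]z, +oo[); last first.
    by apply/seteqP; split=> x /=; rewrite in_itv/= andbT.
  by rewrite -[_ @^-1` _]setTI; exact: mu.
by congr (_ - _)%E; apply: eq_integral => z _; rewrite H.
Qed.

End cptX_cdf.

Section trunc_cdf_is_cdf.
Context (R : realType) (t : R) (G : cdfun R).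

Let G_ge0 x : 0 <= G x.
Proof.
apply: (cvgr_to_le (@cumulativeNy _ _ _ G)).
near=> y; apply: cumulative_is_nondecreasing.
by near: y; apply: nbhs_ninfty_le; rewrite num_real.
Unshelve. all: by end_near. Qed.

Let G_le1 x : G x <= 1.
Proof.
apply: (cvgr_to_ge (@cumulativey _ _ _ G)).
near=> y; apply: cumulative_is_nondecreasing.
by near: y; apply: nbhs_pinfty_ge; rewrite num_real.
Unshelve. all: by end_near. Qed.

Lemma trunc_cdfE x : trunc_cdf t G x =
  if t <= x then 1 else if - t <= x then G x else 0.
Proof.
rewrite /trunc_cdf !indicE !mem_setE !in_itv/= andbT ltNge.
by case: (t <= x); case: (- t <= x); rewrite /= ?(mulr0, mulr1, add0r, addr0).
Qed.

Let trunc_nd : nondecreasing (trunc_cdf t G).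
Proof.
move=> x y xy; rewrite !trunc_cdfE.
case: (leP t x) => [tx|xt]; first by rewrite (le_trans tx xy).
case: (leP t y) => ty; first by case: ifP.
case: (leP (- t) x) => [tx|xt'].
  by rewrite (le_trans tx xy) cumulative_is_nondecreasing.
by case: ifP.
Qed.

Let trunc_rc : right_continuous (trunc_cdf t G).
Proof.
move=> x; rewrite trunc_cdfE; case: (leP t x) => [tx|xt].
  apply: cvg_near_cst; near=> y.
  by rewrite trunc_cdfE (le_trans tx)//; near: y; exact: nbhs_right_ge.
case: (leP (- t) x) => [tx|xt'].
  apply: cvg_trans (@cumulative_is_right_continuous _ _ _ G x).
  apply: near_eq_cvg; near=> y; rewrite trunc_cdfE.
  have yt : y < t by near: y; exact: nbhs_right_lt.
  rewrite leNgt yt/= (le_trans tx)//; near: y; exact: nbhs_right_ge.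
apply: cvg_near_cst; near=> y; rewrite trunc_cdfE.
have yt : y < t by near: y; exact: nbhs_right_lt.
have yt' : y < - t by near: y; exact: nbhs_right_lt.
by rewrite !leNgt yt yt'.
Unshelve. all: by end_near. Qed.

HB.instance Definition _ :=
  isCumulative.Build R _ R (trunc_cdf t G) trunc_nd trunc_rc.

Let trunc_Ny : trunc_cdf t G @ -oo --> (0 : R).
Proof.
apply: cvg_near_cst; near=> y; rewrite trunc_cdfE.
have yt : y < t by near: y; apply: nbhs_ninfty_lt; rewrite num_real.
have yt' : y < - t by near: y; apply: nbhs_ninfty_lt; rewrite num_real.
by rewrite !leNgt yt yt'.
Unshelve. all: by end_near. Qed.

Let trunc_y : trunc_cdf t G @ +oo --> (1 : R).
Proof.
apply: cvg_near_cst; near=> y; rewrite trunc_cdfE.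
have -> // : t <= y by near: y; apply: nbhs_pinfty_ge; rewrite num_real.
Unshelve. all: by end_near. Qed.

HB.instance Definition _ :=
  isCumulativeBounded.Build R 0 1 (trunc_cdf t G) trunc_Ny trunc_y.

End trunc_cdf_is_cdf.

(* Main.v *)
(* Let u be one of the two utilities, b its value at the truncation point, and
   T_M(z) = M{u > z}.  Truncating G at level tau is pushing its law forward by
   x |-> max(-tau, min(x, tau)), which replaces u by min(u, b); hence the tail
   of the truncated law equals T_G on [0, b[ and vanishes on [b, +oo[.
   On [b, +oo[ only w(T_F) <= L T_F^alpha remains, and u(x) <= K |x| bounds it
   by the tail of F at z / K; as b >= k tau, rescaling z gives the two remainder
   integrals.  On [0, b[ the Hoelder condition on w and Hoelder's inequality give
   at most L (int |T_F - T_G|)^alpha b^(1 - alpha), where b <= K tau, and for a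
   coupling (X, Y) Tonelli gives
   int |T_F - T_G| dz <= E |u(X) - u(Y)| <= K E |X - Y|.
   The loss side reduces to the gain side by the reflection x |-> -x. *)
Require Import Defs.
From HB Require Import structures.
From mathcomp Require Import all_boot all_order all_algebra.
From mathcomp Require Import all_classical all_reals all_analysis.
From mathcomp Require Import measurable_realfun lra ring.

Set Implicit Arguments.
Unset Strict Implicit.

Import Order.TTheory GRing.Theory Num.Theory.
Import numFieldNormedType.Exports.

Local Open Scope classical_set_scope.
Local Open Scope ring_scope.

(** * Integrals of powers and of differences of tails *)

(** Hölder's inequality for [f ^ alpha] and the indicator of [A], with conjugate exponents
    [1 / alpha] and [1 / (1 - alpha)]. The case [alpha = 1] is apart, as its second exponent would
    be infinite. *)
Lemma integral_powR_le d (T : measurableType d) (R : realType)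
    (mu : {measure set T -> \bar R}) (A : set T) (f : T -> R) (alpha : R) :
  measurable A -> measurable_fun A f -> (forall t, A t -> 0 <= f t) ->
  0 < alpha -> alpha <= 1 ->
  (\int[mu]_(t in A) (f t `^ alpha)%:E
   <= (\int[mu]_(t in A) (f t)%:E) `^ alpha * mu A `^ (1 - alpha))%E.
Proof.
move=> mA mf f0 a0; rewrite le_eqVlt => /predU1P[->|a1].
  (* [poweRe0] gives [mu A ^ 0 = 1] even when [mu A] is 0 or [+oo]. *)
  rewrite subrr poweRe0 mule1 poweRe1.
    by rewrite (eq_integral (fun t => (f t)%:E))// => t /set_mem/f0/powRr1 ->.
  by apply: integral_ge0 => t At; rewrite lee_fin f0.
have mfA : measurable_fun setT (f \_ A) by exact/(measurable_restrictT _ _).1.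
have mfa : measurable_fun setT (fun t => (f \_ A) t `^ alpha).
  exact: (@measurableT_comp _ _ _ _ _ _ (@powR R ^~ alpha)).
have fA0 t : 0 <= (f \_ A) t.
  by rewrite patchE; case: ifPn => // /set_mem/f0.
have := @hoelder _ _ _ mu (fun t => (f \_ A) t `^ alpha) (\1_A)
   alpha^-1 (1 - alpha)^-1 mfa (measurable_indic mA).
rewrite !invr_gt0 subr_gt0 a0 a1 !invrK subrKC => /(_ isT isT erefl).
rewrite Lnorm1 unlock /Lnorm /= !invrK.
rewrite (_ : (\int[mu]_x _)%E = (\int[mu]_(t in A) (f t `^ alpha)%:E)%E); last first.
  rewrite [RHS]integral_mkcond; apply: eq_integral => t _.
  rewrite /= indicE !patchE; case: ifPn => tA; rewrite ?mulr1 ?mulr0 ?normr0//.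
  by rewrite ger0_norm// powR_ge0.
rewrite (_ : (\int[mu]_x (`|(f \_ A) x `^ alpha| `^ alpha^-1)%:E)%E = (\int[mu]_(t in A) (f t)%:E)%E); last first.
  rewrite [RHS]integral_mkcond; apply: eq_integral => t _.
  rewrite /= ger0_norm ?powR_ge0// -powRrM divff ?gt_eqF// powRr1// !patchE.
  by case: ifPn.
rewrite (_ : (\int[mu]_x (`|\1_A x| `^ (1 - alpha)^-1)%:E)%E = mu A)//.
rewrite -[in RHS](setIT A) -(@integral_indic _ _ _ mu setT measurableT A mA)//; apply: eq_integral => t _.
rewrite /= indicE; case: (t \in A); rewrite /= ?normr1 ?powR1// normr0 powR0//.
by rewrite invr_neq0// subr_eq0 gt_eqF.
Qed.

Lemma probability_dist_le d (T : measurableType d) (R : realType)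
    (P : probability T R) (A B C : set T) :
  measurable A -> measurable B -> measurable C ->
  A `<=` B `|` C -> B `<=` A `|` C ->
  ((`|fine (P A) - fine (P B)|)%:E <= P C)%E.
Proof.
move=> mA mB mC ABC BAC.
have H D E : measurable D -> measurable E -> D `<=` E `|` C ->
    fine (P D) - fine (P E) <= fine (P C).
  move=> mD mE DEC; rewrite lerBlDl -lee_fin EFinD !fineK ?fin_num_measure//.
  apply: (le_trans _ (@measureU2 _ _ _ P _ _ mE mC)).
  by apply: le_measure; rewrite ?inE//; exact: measurableU.
rewrite -[leRHS]fineK ?fin_num_measure// lee_fin ler_norml lerNl opprB.
by rewrite !H.
Qed.

Lemma measurable_superlevel d (T : measurableType d) (R : realType)
    (X : T -> R) (z : R) :
  measurable_fun setT X -> measurable [set t | z < X t].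
Proof.
move=> mX; rewrite (_ : [set _ | _] = setT `&` X @^-1` `]z, +oo[); first exact: mX.
by apply/seteqP; split => t /=; rewrite in_itv/= andbT// => -[].
Qed.

Lemma tail_nonincreasing d (T : measurableType d) (R : realType)
    (P : probability T R) (X : T -> R) :
  measurable_fun setT X ->
  nonincreasing_fun (fun z => fine (P [set t | z < X t])).
Proof.
move=> mX x y xy; rewrite fine_le ?fin_num_measure ?le_measure ?inE//;
  try exact: measurable_superlevel.
by move=> t /=; exact: le_lt_trans.
Qed.

(** Tonelli on the region between the minimum and the maximum of [X] and [Y]: its section at [t] has
    length [|X t - Y t|], and its section at [z] is the event where exactly one of [X], [Y] exceeds
    [z]. *)
Lemma integral_tail_dist_le d (T : measurableType d) (R : realType)
    (P : probability T R) (X Y : T -> R) :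
  measurable_fun setT X -> measurable_fun setT Y ->
  (\int[lebesgue_measure]_z
      (`|fine (P [set t | z < X t]) - fine (P [set t | z < Y t])|)%:E
   <= \int[P]_t (`|X t - Y t|)%:E)%E.
Proof.
move=> mX mY.
pose m t := Num.min (X t) (Y t); pose M t := Num.max (X t) (Y t).
have mm : measurable_fun setT m by exact: measurable_minr.
have mM : measurable_fun setT M by exact: measurable_maxr.
(* Closed below and open above: the strict superlevel sets differ at [t] when [Y t <= z < X t], or
   the same with [X] and [Y] exchanged. *)
pose A : set (T * measurableTypeR R) := [set p | m p.1 <= p.2 < M p.1].
have mA : measurable A.
  have -> : A = (setT `&` (fun p : T * measurableTypeR R => p.2 - m p.1) @^-1` `[0, +oo[)
     `&` (setT `&` (fun p : T * measurableTypeR R => M p.1 - p.2) @^-1` `]0, +oo[).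
    apply/seteqP; split => p; rewrite /A/= !in_itv/= !andbT subr_ge0 subr_gt0.
      by move=> /andP[].
    by move=> [[_ ->] [_ ->]].
  have m1 : measurable_fun setT (fun p : T * measurableTypeR R => p.2 - m p.1).
    by apply: measurable_funB => //; exact: measurableT_comp.
  have m2 : measurable_fun setT (fun p : T * measurableTypeR R => M p.1 - p.2).
    by apply: measurable_funB => //; exact: measurableT_comp.
  by apply: measurableI; [apply: m1|apply: m2].
have := @indic_fubini_tonelli _ _ _ _ _ P (@lebesgue_measure R) A mA.
rewrite indic_fubini_tonelli_FE// indic_fubini_tonelli_GE// => E.
rewrite (eq_integral (fun t => lebesgue_measure (xsection A t))); last first.
  move=> t _; rewrite (_ : xsection A t = `[m t, M t[%classic).
    rewrite lebesgue_measure_itv/= lte_fin -EFinD /m /M.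
    by case: (ltgtP (X t) (Y t)) => [xy|xy|->]; rewrite ?ltxx ?subrr ?normr0//= ?xy//;
      [rewrite ltr0_norm ?opprB// subr_lt0|rewrite ger0_norm// subr_ge0 ltW].
  by apply/seteqP; split => z; rewrite /xsection /A /= inE/= in_itv.
rewrite E; apply: ge0_le_integral => //=.
- apply/measurable_EFinP; apply: measurableT_comp => //.
  by apply: measurable_funB; apply: nonincreasing_measurable => //;
    exact: tail_nonincreasing.
- exact: measurable_fun_ysection.
move=> z _; apply: probability_dist_le; [exact: measurable_superlevel..| | |].
- by have := measurable_ysection z mA.
- move=> t /= zX; rewrite /ysection /A /= inE/= /m /M.
  have [zY|Yz] := ltP z (Y t); [by left|right].
  by rewrite ge_min lt_max Yz zX orbT.
- move=> t /= zY; rewrite /ysection /A /= inE/= /m /M.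
  have [zX|Xz] := ltP z (X t); [by left|right].
  by rewrite ge_min lt_max Xz zY orbT.
Qed.

(** * Linear change of variables for Lebesgue measure *)

(** By uniqueness of Lebesgue measure, it suffices that [|a|] times its pushforward under
    [z |-> a * z] gives each []x, y]] its length. *)
Lemma lebesgue_measure_scale (R : realType) (a : R) (A : set R) :
  a != 0 -> measurable A ->
  lebesgue_measure [set z | A (a * z)] = (`|a|^-1%:E * lebesgue_measure A)%E.
Proof.
move=> a0 mA.
pose s (z : measurableTypeR R) : measurableTypeR R := a * z.
have ms : measurable_fun setT s by exact: measurable_funM.
(* The measure structure of a pushforward takes the measurability proof [ms]
   as an argument, hence the detour through [mu_]. *)
pose mu_ := mscale (NngNum (normr_ge0 a)) (pushforward (@lebesgue_measure R) s).
pose mu := ltac:(let t := eval cbv beta delta [mu_] in (mu_ ms) in exact t).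
have -> : lebesgue_measure A = mu A.
  apply: lebesgue_measure_unique => // _ [[x y]] _ <-.
  rewrite -[RHS]/(`|a|%:E * lebesgue_measure [set z | (a * z)%R \in `]x, y]])%E.
  (* For [a < 0] the preimage of []x, y]] is [[y / a, x / a[]: the closed end changes side. *)
  have [aN|aP|/eqP] := ltgtP a 0; last by rewrite (negbTE a0).
  - rewrite (_ : [set z | a * z \in `]x, y]] = `[y / a, x / a[%classic); last first.
      apply/seteqP; split=> z /=; rewrite !in_itv/= /s => /andP[].
        by rewrite ler_ndivrMr// ltr_ndivlMr// ![z * a]mulrC => H1 H2; apply/andP.
      by rewrite ler_ndivrMr// ltr_ndivlMr// ![z * a]mulrC => H1 H2; apply/andP.
    rewrite !lebesgue_measure_itv/= !lte_fin ltr_nM2r ?invr_lt0//.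
    case: ltP => _; rewrite ?mule0//. rewrite -!EFinD -EFinM ltr0_norm//.
    by congr (_%:E); field; rewrite lt_eqF.
  - rewrite (_ : [set z | a * z \in `]x, y]] = `]x / a, y / a]%classic); last first.
      apply/seteqP; split=> z /=; rewrite !in_itv/= /s => /andP[].
        by rewrite ler_pdivlMr// ltr_pdivrMr// ![z * a]mulrC => H1 H2; apply/andP.
      by rewrite ler_pdivlMr// ltr_pdivrMr// ![z * a]mulrC => H1 H2; apply/andP.
    rewrite !lebesgue_measure_itv/= !lte_fin ltr_pM2r ?invr_gt0//.
    case: ltP => _; rewrite ?mule0// -!EFinD -EFinM gtr0_norm//.
    by congr (_%:E); field; rewrite gt_eqF.
by rewrite /mu /mscale/= muleA -EFinM mulVf ?normr_eq0// mul1e.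
Qed.

Lemma ge0_integral_scale (R : realType) (a : R) (D : set R) (f : R -> \bar R) :
  a != 0 -> measurable D -> measurable_fun D f -> (forall x, D x -> 0 <= f x)%E ->
  (\int[lebesgue_measure]_(z in [set z | D (a * z)%R]) f (a * z)%R
   = (`|a|^-1)%:E * \int[lebesgue_measure]_(x in D) f x)%E.
Proof.
move=> a0 mD mf f0.
pose s (z : measurableTypeR R) : measurableTypeR R := a * z.
have ms : measurable_fun setT s by exact: measurable_funM.
have na : 0 <= `|a|^-1 by rewrite invr_ge0.
rewrite -[LHS](@ge0_integral_pushforward _ _ _ _ R s ms lebesgue_measure D f); last 3 first.
- exact: mD.
- exact: mf.
- by move=> y /set_mem; exact: f0.
have := @ge0_integral_mscale _ (measurableTypeR R) R (@lebesgue_measure R) D mD (NngNum na) f mf f0.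
move=> /= <-.
apply: eq_measure_integral => A mA _ /=.
exact: lebesgue_measure_scale.
Qed.

(** * Laws on the line: truncation, couplings and the Wasserstein distance *)

(** Under the law of [G] the clamp is a random variable with cdf [trunc_cdf tau G], and a cdf
    determines the law. *)
Lemma trunc_cdf_measure (R : realType) (tau : R) (G : cdfun R) (A : set R) :
  0 < tau -> measurable A ->
  lebesgue_stieltjes_measure (trunc_cdf tau G) A =
  lebesgue_stieltjes_measure G [set x | A (Num.max (- tau) (Num.min x tau))].
Proof.
move=> tau0 mA.
pose c (x : measurableTypeR R) : R := Num.max (- tau) (Num.min x tau).
have mc : measurable_fun setT c.
  by apply: measurable_maxr => //; apply: measurable_minr.
pose X : {RV (lebesgue_stieltjes_measure G) >-> R} := HB.pack c
  (isMeasurableFun.Build _ _ _ _ c mc).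
apply: (@lebesgue_stieltjes_distribution _ _ _ (lebesgue_stieltjes_measure G) X) => // r.
have := cdf_lebesgue_stieltjes_id G r.
rewrite /cdf /distribution/= /pushforward /= => GE.
rewrite trunc_cdfE.
(* The event that the clamp is at most [r] is everything for [tau <= r], the half-line [x <= r] for
   [- tau <= r < tau], and empty for [r < - tau]. *)
have [taur|rtau] := leP tau r.
  rewrite (_ : _ @^-1` _ = setT) ?probability_setT//.
  apply/seteqP; split => x //= _.
  by rewrite in_itv/= /c ge_max !ge_min taur orbT (le_trans _ taur) ?gtrN// ltW ?gtrN.
have [taur|rtau'] := leP (- tau) r.
  rewrite -GE; congr (_ _); apply/seteqP; split => x /=;
    by rewrite !in_itv/= /c ge_max !ge_min taur [tau <= r]leNgt rtau orbF.
rewrite (_ : _ @^-1` _ = set0) ?measure0//.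
apply/seteqP; split => x //=.
by rewrite in_itv/= /c ge_max leNgt rtau'.
Qed.

Lemma lebesgue_stieltjes_gt (R : realType) (F : cdfun R) (x : R) :
  lebesgue_stieltjes_measure F `]x, +oo[ = (1 - F x)%:E.
Proof.
have := cdf_lebesgue_stieltjes_id F x.
rewrite /cdf /distribution/= /pushforward preimage_id => FE.
rewrite -setCitvl probability_setC; last exact: measurable_itv.
by rewrite EFinB -FE.
Qed.

Lemma lebesgue_stieltjes_le (R : realType) (F : cdfun R) (x : R) :
  lebesgue_stieltjes_measure F `]-oo, x] = (F x)%:E.
Proof.
have := cdf_lebesgue_stieltjes_id F x.
by rewrite /cdf /distribution/= /pushforward preimage_id.
Qed.

(** [coupling] constrains half-lines only; viewing the two projections as random variables with cdfs
    [F] and [G] extends it to all Borel sets. *)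
Lemma coupling_marginals (R : realType) (F G : cdfun R) (g : probability (R * R)%type R)
    (A : set R) : coupling F G g -> measurable A ->
  lebesgue_stieltjes_measure F A = g [set p | A p.1] /\
  lebesgue_stieltjes_measure G A = g [set p | A p.2].
Proof.
move=> gFG mA.
have m1 : measurable_fun setT (fst : R * R -> R) by exact: measurable_fst.
have m2 : measurable_fun setT (snd : R * R -> R) by exact: measurable_snd.
pose X1 : {RV g >-> R} := HB.pack (fst : R * R -> R)
  (isMeasurableFun.Build _ _ _ _ _ m1).
pose X2 : {RV g >-> R} := HB.pack (snd : R * R -> R)
  (isMeasurableFun.Build _ _ _ _ _ m2).
split.
  apply: (@lebesgue_stieltjes_distribution _ _ _ g X1) => // r.
  have [<- _] := gFG r; congr (g _).
  by apply/seteqP; split => p //= [].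
apply: (@lebesgue_stieltjes_distribution _ _ _ g X2) => // r.
have [_ <-] := gFG r; congr (g _).
by apply/seteqP; split => p //= [].
Qed.

(** Each coupling bounds the left side by the mean of [|u X - u Y|], hence by [K] times its
    transport cost. *)
Lemma integral_tail_dist_wasserstein1 (R : realType) (u : R -> R) (K : R)
    (F G : cdfun R) :
  measurable_fun setT u -> 0 < K -> (forall x y, `|u x - u y| <= K * `|x - y|) ->
  (\int[lebesgue_measure]_z
     (`|fine (lebesgue_stieltjes_measure F [set x | z < u x])
        - fine (lebesgue_stieltjes_measure G [set x | z < u x])|)%:E
   <= K%:E * wasserstein1 F G)%E.
Proof.
(* Dividing by [K] leaves a bare infimum, so couplings can be treated one at a time. *)
move=> mu K0 uK; rewrite -lee_pdivrMl//; apply: le_ereal_inf_tmp => _ [g gFG <-].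
rewrite lee_pdivrMl//.
have m1 : measurable_fun setT (fst : R * R -> R) by exact: measurable_fst.
have m2 : measurable_fun setT (snd : R * R -> R) by exact: measurable_snd.
have mX : measurable_fun setT (fun p : R * R => u p.1).
  exact: measurableT_comp.
have mY : measurable_fun setT (fun p : R * R => u p.2).
  exact: measurableT_comp.
rewrite (_ : (\int[_]_z _)%E = (\int[lebesgue_measure]_z
  (`|fine (g [set p | z < u p.1]) - fine (g [set p | z < u p.2])|)%:E)%E); last first.
  apply: eq_integral => z _.
  by have [-> ->] := coupling_marginals gFG (measurable_superlevel z mu).
apply: (le_trans (integral_tail_dist_le g mX mY)).
have md : measurable_fun setT (fun p : R * R => (`|p.1 - p.2|)%:E).
  by apply/measurable_EFinP; apply: measurableT_comp => //; exact: measurable_funB.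
rewrite -ge0_integralZl_EFin; [|by []|by []|exact: md|exact: ltW].
apply: ge0_le_integral => //.
- apply/measurable_EFinP; apply: measurableT_comp => //.
  exact: measurable_funB.
- exact: measurable_funeM.
- by move=> p _; rewrite -EFinM lee_fin uK.
Qed.

(** * The truncation bound for a single utility *)

Section truncation.
Context (R : realType) (u w H : R -> R) (K k L alpha tau b : R) (F G : cdfun R).
Hypotheses (K0 : 0 < K) (k0 : 0 < k) (L0 : 0 < L) (tau0 : 0 < tau).
Hypotheses (alpha0 : 0 < alpha) (alpha1 : alpha <= 1).
Hypotheses (mu : measurable_fun setT u).
Hypothesis uK : forall x y, `|u x - u y| <= K * `|x - y|.
Hypotheses (kb : k * tau <= b) (bK : b <= K * tau).
(** In both uses [u] vanishes on a half-line, so only the other end of the clamp is felt, and [b] is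
    the value of [u] there. *)
Hypothesis u_clamp : forall x,
  u (Num.max (- tau) (Num.min x tau)) = Num.min (u x) b.
Hypothesis w_nd : {in `[0, 1] &, {homo w : p q / p <= q}}.
Hypothesis w0 : w 0 = 0.
Hypothesis w_holder : {in `[0, 1] &, forall p q,
   `|w p - w q| <= L * `|p - q| `^ alpha}.

Let tail (M : cdfun R) z := fine (lebesgue_stieltjes_measure M [set x | z < u x]).

(** [H] hides the side: it will be [1 - F (z / K)] for gains and [F (- z / K)] for losses. *)
Hypothesis mH : measurable_fun setT H.
Hypothesis tailH : forall z : R, 0 <= z -> tail F z <= H z.

Let mlevel z : measurable [set x | z < u x].
Proof. exact: measurable_superlevel. Qed.

Let tail_itv M z : tail M z \in `[0, 1].
Proof.
have mA := mlevel z.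
rewrite in_itv/= fine_ge0//= -lee_fin fineK; first exact: probability_le1.
exact: fin_num_measure.
Qed.

Let mtail M : measurable_fun setT (tail M).
Proof.
by apply: nonincreasing_measurable => //; exact: tail_nonincreasing.
Qed.

Let mwtail M : measurable_fun setT (fun z => w (tail M z)).
Proof.
apply: nonincreasing_measurable => // x y xy; apply: w_nd => //.
by apply: tail_nonincreasing.
Qed.

Let wtail_ge0 M z : 0 <= w (tail M z).
Proof.
have /andP[t0 t1] := tail_itv M z.
by rewrite -w0; apply: w_nd; rewrite ?tail_itv// in_itv/= lexx ler01.
Qed.

Let tail_truncE z : tail (trunc_cdf tau G) z = if z < b then tail G z else 0.
Proof.
rewrite /tail trunc_cdf_measure// /=.
case: ltP => zb; last first.
  rewrite (_ : [set _ | _] = set0) ?measure0//.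
  by apply/seteqP; split => x //=; rewrite u_clamp lt_min (ltNge z b) zb andbF.
congr (fine (_ _)); apply/seteqP; split => x /=;
  by rewrite u_clamp lt_min zb andbT.
Qed.

Let b_ge0 : 0 <= b.
Proof. by rewrite (le_trans _ kb)// mulr_ge0// ltW. Qed.

(** The Lipschitz constant contributes [K ^ alpha], and the length of [[0, b[], at most [K * tau],
    contributes [K ^ (1 - alpha)]; together they give the factor [K]. *)
Let integral_dist_powR :
  (\int[lebesgue_measure]_(z in `[0%R, b[)
     (`|tail F z - tail G z| `^ alpha)%:E
   <= K%:E * wasserstein1 F G `^ alpha * (tau `^ (1 - alpha))%:E)%E.
Proof.
have mD : measurable_fun setT (fun z => `|tail F z - tail G z|).
  by apply: measurableT_comp => //; exact: measurable_funB.
apply: (le_trans (@integral_powR_le _ _ _ lebesgue_measure _ _ _ _ _ _ alpha0 alpha1)) => //.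
  exact: measurable_funTS.
have W0 : (0 <= wasserstein1 F G)%E.
  apply: le_ereal_inf_tmp => _ [g _ <-]; exact: integral_ge0.
have leb : (lebesgue_measure `[0%R, b[ <= (K * tau)%:E)%E.
  rewrite lebesgue_measure_itv/= lte_fin; case: ltP => _.
    by rewrite -EFinD subr0 lee_fin.
  by rewrite lee_fin mulr_ge0// ltW.
apply: (@le_trans _ _ ((K%:E * wasserstein1 F G) `^ alpha
                         * (K * tau)%:E `^ (1 - alpha))%E).
  apply: lee_pmul; rewrite ?poweR_ge0//.
    apply: gt0_ler_poweR; rewrite ?in_itv/= ?leey ?andbT ?(ltW alpha0)//.
    - by apply: integral_ge0.
    - by rewrite mule_ge0// lee_fin ltW.
    apply: (le_trans _ (integral_tail_dist_wasserstein1 F G mu K0 uK)).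
    by apply: ge0_subset_integral => //; exact/measurable_EFinP.
  apply: gt0_ler_poweR; rewrite ?in_itv/= ?leey ?andbT ?subr_ge0//.
  by rewrite lee_fin mulr_ge0// ltW.
rewrite poweRM ?lee_fin ?(ltW K0)// !poweR_EFin powRM ?(ltW K0, ltW tau0)// EFinM.
rewrite muleACA -EFinM -powRD ?subrKC ?powRr1 ?(ltW K0)//; first by rewrite muleA.
by rewrite oner_eq0.
Qed.

(** Finiteness for the truncated law is part of the conclusion because the gain and loss differences
    are later regrouped among finite numbers. *)
Lemma truncation_bound :
  (\int[lebesgue_measure]_(z in `[0%R, +oo[) (w (tail F z))%:E)%E \is a fin_num ->
  (\int[lebesgue_measure]_(z in `[0%R, +oo[) (w (tail (trunc_cdf tau G) z))%:E)%E
    \is a fin_num /\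
  (`| \int[lebesgue_measure]_(z in `[0%R, +oo[) (w (tail F z))%:E
   - \int[lebesgue_measure]_(z in `[0%R, +oo[) (w (tail (trunc_cdf tau G) z))%:E |
   <= (L * K)%:E * wasserstein1 F G `^ alpha * (tau `^ (1 - alpha))%:E
      + L%:E * \int[lebesgue_measure]_(z in `[(k * tau)%R, +oo[) (H z `^ alpha)%:E)%E.
Proof.
move=> Ffin.
have m0y : measurable (`[0, +oo[ : set R) by exact: measurable_itv.
have iF : lebesgue_measure.-integrable `[0, +oo[ (EFin \o (fun z => w (tail F z))).
  apply/integrableP; split; first by apply/measurable_EFinP; exact: (measurable_funTS (mwtail F)).
  under eq_integral do rewrite /= ger0_norm//.
  by rewrite ltey_eq Ffin.
(* From [b] on the truncated tail vanishes and [w 0 = 0], while on [[0, b[], of finite length, the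
   integrand is at most [w 1]. *)
have Glt : (\int[lebesgue_measure]_(z in `[0%R, +oo[) (w (tail (trunc_cdf tau G) z))%:E < +oo)%E.
  apply: (@le_lt_trans _ _ (\int[lebesgue_measure]_(z in `[0%R, b[) (cst (w 1)%:E z))%E).
    rewrite -(@setIidr _ `[0, +oo[ `[0, b[); last by apply: subset_itvl.
    rewrite integral_mkcondr; apply: ge0_le_integral => //.
    - by move=> z _; rewrite lee_fin.
    - by apply/measurable_EFinP; exact: (measurable_funTS (mwtail (trunc_cdf tau G))).
    - by apply/measurable_restrict => //; exact: measurable_cst.
    move=> z; rewrite patchE mem_setE /= !in_itv/= andbT => ->/=.
    rewrite tail_truncE; case: ifPn => zb; rewrite lee_fin ?w0//.
    apply: w_nd; [exact: tail_itv|by rewrite in_itv/= lexx ler01|].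
    by have /andP[] := tail_itv G z.
  by rewrite integral_cst//= lebesgue_measure_itv/= lte_fin; case: ifP => _; rewrite ?mule0// -EFinM ltry.
have iG : lebesgue_measure.-integrable `[0, +oo[ (EFin \o (fun z => w (tail (trunc_cdf tau G) z))).
  apply/integrableP; split; first by apply/measurable_EFinP; exact: (measurable_funTS (mwtail (trunc_cdf tau G))).
  by under eq_integral do rewrite /= ger0_norm//.
split; first by rewrite ge0_fin_numE// integral_ge0// => z _; rewrite lee_fin.
rewrite -integralB_EFin//.
have mfh := measurable_funB (mwtail F) (mwtail (trunc_cdf tau G)).
apply: (le_trans (le_abse_integral _ _ _)) => //.
  by apply/measurable_EFinP; exact: (measurable_funTS mfh).
pose d z := `|w (tail F z) - w (tail (trunc_cdf tau G) z)|.
rewrite [leLHS](_ : _ = \int[lebesgue_measure]_(z in `[0%R, +oo[) (d z)%:E)%E//.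
have md : measurable_fun setT d by exact: measurableT_comp.
have itvU : `[0, +oo[%classic = `[0, b[%classic `|` `[b, +oo[%classic :> set R.
  apply/seteqP; split => z /=; rewrite !in_itv/= !andbT.
    by move=> ->; case: ltP; [left|right].
  by move=> [/andP[]//|]; exact: le_trans.
rewrite itvU ge0_integral_setU//; last 3 first.
- by apply/measurable_EFinP; exact: measurable_funTS.
- by move=> z _; rewrite lee_fin /d.
- rewrite disj_set2E; apply/eqP/seteqP; split => z //=; rewrite !in_itv/= andbT.
  by move=> [/andP[_ zb]]; rewrite leNgt zb.
have mHa : measurable_fun setT (fun z => H z `^ alpha).
  exact: (@measurableT_comp _ _ _ _ _ _ (@powR R ^~ alpha)).
have mDa : measurable_fun setT (fun z => `|tail F z - tail G z| `^ alpha).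
  apply: (@measurableT_comp _ _ _ _ _ _ (@powR R ^~ alpha)) => //.
  by apply: measurableT_comp => //; exact: measurable_funB.
apply: leeD.
  apply: (@le_trans _ _ (L%:E * \int[lebesgue_measure]_(z in `[0%R, b[)
     (`|tail F z - tail G z| `^ alpha)%:E)%E); last first.
    rewrite EFinM -!muleA; rewrite lee_pmul2l//.
    by rewrite muleA integral_dist_powR.
  rewrite -ge0_integralZl_EFin; [|by []|by move=> z _; rewrite lee_fin powR_ge0| |exact: ltW]; last first.
    by apply/measurable_EFinP; exact: measurable_funTS.
  apply: ge0_le_integral => //.
  - by move=> z _; rewrite lee_fin /d.
  - by apply/measurable_EFinP; exact: measurable_funTS.
  - by apply: measurable_funeM; by apply/measurable_EFinP; exact: measurable_funTS.
  - move=> z /=; rewrite in_itv/= => /andP[_ zb].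
    by rewrite -EFinM lee_fin /d tail_truncE zb; apply: w_holder.
rewrite -ge0_integralZl_EFin; [|by []|by move=> z _; rewrite lee_fin powR_ge0| |exact: ltW]; last first.
  by apply/measurable_EFinP; exact: measurable_funTS.
have mLH : measurable_fun setT (fun z => L%:E * (H z `^ alpha)%:E)%E.
  by apply: measurable_funeM; exact/measurable_EFinP.
(* As [k * tau <= b], enlarging the domain frees the remainder from the value of [b]. *)
apply: (@le_trans _ _ (\int[lebesgue_measure]_(z in `[b, +oo[) (L%:E * (H z `^ alpha)%:E))%E); last first.
  apply: ge0_subset_integral => //.
  - exact: measurable_funTS.
  - by move=> z _; rewrite mule_ge0 ?lee_fin ?powR_ge0 ?ltW.
  - by move=> z /=; rewrite !in_itv/= !andbT; exact: le_trans.
apply: ge0_le_integral => //.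
- by move=> z _; rewrite lee_fin /d.
- by apply/measurable_EFinP; exact: measurable_funTS.
- exact: measurable_funTS.
- move=> z /=; rewrite in_itv/= andbT => bz.
  have z0 : 0 <= z by exact: le_trans bz.
  have /andP[t0 t1] := tail_itv F z.
  (* The truncated tail is 0 here, so the Hölder condition is used with [q = 0]; [H] then replaces
     the tail of [F] by monotonicity of the power. *)
  rewrite -EFinM lee_fin /d tail_truncE ltNge bz/=.
  apply: (le_trans (w_holder _ _)); rewrite ?tail_itv// ?in_itv/= ?lexx ?ler01//.
  rewrite subr0 ger0_norm// ler_pM2l//; apply: ge0_ler_powR.
  - exact: ltW.
  - by rewrite nnegrE.
  - by rewrite nnegrE (le_trans _ (tailH z0)).
  - exact: tailH.
Qed.
End truncation.

(** * Slope, level and clamp estimates for the gain utility *)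

Section gain.
Context (R : realType) (v : R -> R) (k K : R).
Hypotheses (v_cont : continuous v) (v_ge0 : forall x, 0 <= v x).
Hypothesis v_eq0 : forall x, x <= 0 -> v x = 0.
Hypothesis v_incr : {in `[0, +oo[ &, {homo v : x y / x < y}}.
Hypotheses (k0 : 0 < k) (K0 : 0 < K).
Hypothesis v_deriv : forall x, 0 < x ->
  derivable v x 1 /\ k <= `|v^`()%classic x| <= K.

Lemma gain_nd x y : x <= y -> v x <= v y.
Proof.
rewrite le_eqVlt => /predU1P[->//|xy].
have [x0|x0] := leP x 0; first by rewrite (v_eq0 x0).
by apply/ltW/v_incr => //; rewrite in_itv/= andbT ltW// (lt_trans x0).
Qed.

(** Mean value theorem on [[x, y]]; only interior derivatives enter, so [x = 0] is allowed. *)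
Lemma gain_slope x y : 0 <= x -> x <= y ->
  k * (y - x) <= v y - v x <= K * (y - x).
Proof.
move=> x0; rewrite le_eqVlt => /predU1P[<-|xy].
  by rewrite !subrr !mulr0 lexx.
have dv z : z \in `]x, y[ -> is_derive z 1 v (v^`()%classic z).
  rewrite in_itv/= => /andP[xz _].
  have [dv _] := v_deriv (le_lt_trans x0 xz).
  by rewrite derive1E; exact/derivableP.
have [z /[1!in_itv]/= /andP[xz _] E] :=
  MVT xy dv (continuous_subspaceT v_cont).
have yx0 : 0 < y - x by rewrite subr_gt0.
(* Monotonicity makes the mean slope nonnegative, which removes the absolute value from the
   derivative bounds. *)
have d0 : 0 <= v^`()%classic z.
  by rewrite -(pmulr_lge0 _ yx0) -E subr_ge0 gain_nd// ltW.
have [_] := v_deriv (le_lt_trans x0 xz).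
by rewrite ger0_norm// E !ler_pM2r.
Qed.

Lemma gain_lipschitz x y : `|v x - v y| <= K * `|x - y|.
Proof.
wlog xy : x y / x <= y => [H|].
  have [/H//|/ltW/H] := leP x y.
  by rewrite distrC [X in _ <= _ * X]distrC.
rewrite distrC [X in _ <= _ * X]distrC !ger0_norm ?subr_ge0 ?gain_nd//.
have [y0|y0] := leP y 0.
  by rewrite !v_eq0 ?(le_trans xy)// subrr mulr_ge0 ?subr_ge0// ltW.
have [x0|x0] := leP 0 x; first by have /andP[] := gain_slope x0 xy.
(* Here [x < 0 < y]; replacing [x] by 0 keeps the utility and shortens the interval. *)
rewrite (v_eq0 (ltW x0)) -(v_eq0 (lexx 0)).
have /andP[_ /le_trans] := gain_slope (lexx 0) (ltW y0); apply.
by rewrite ler_pM2l// lerD2l lerN2 ltW.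
Qed.

(** A level [z >= 0] is exceeded only at some [x > 0], where [v x <= K * x]; this yields the tail
    bound by [1 - F (z / K)]. *)
Lemma gain_level x z : 0 <= z -> z < v x -> z / K < x.
Proof.
move=> z0 zx; have [x0|x0] := leP x 0.
  by move: zx; rewrite v_eq0// ltNge z0.
rewrite ltr_pdivrMr// mulrC (lt_le_trans zx)//.
have /andP[_] := gain_slope (lexx 0) (ltW x0).
by rewrite (v_eq0 (lexx 0)) !subr0.
Qed.

Lemma gain_bounds t : 0 <= t -> k * t <= v t <= K * t.
Proof.
by move=> /(gain_slope (lexx 0)); rewrite (v_eq0 (lexx 0)) !subr0.
Qed.

(** The upper cap commutes with [v] by monotonicity; the lower one moves only points where [v] is 0
    before and after. *)
Lemma gain_clamp t x : 0 < t ->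
  v (Num.max (- t) (Num.min x t)) = Num.min (v x) (v t).
Proof.
move=> t0; have [xt|tx] := leP x t.
  rewrite (min_idPl (gain_nd xt)); case: (leP (- t) x) => // xt'.
  by rewrite !v_eq0// ?oppr_le0 ltW// (lt_trans xt')// oppr_lt0.
by rewrite (min_idPr (gain_nd (ltW tx))) (max_idPr _)// ge0_cp// ltW.
Qed.

End gain.

(** * Reflection, and the loss utility *)

Lemma oppr_clamp (R : realType) (t x : R) : 0 < t ->
  - Num.max (- t) (Num.min x t) = Num.max (- t) (Num.min (- x) t).
Proof.
move=> t0; case: (leP x t) => xt; case: (leP (- x) t) => xt';
  repeat match goal with |- context [Order.max ?a ?b] => case: (leP a b) => ? end;
  lra.
Qed.

(** Chain rule with inner derivative [-1]; the sign will disappear under the absolute value in the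
    derivative bounds. *)
Lemma is_derive_reflect (R : realType) (f : R -> R) (x : R) :
  derivable f (- x) 1 ->
  derivable (fun y => f (- y)) x 1 /\
  (fun y => f (- y))^`()%classic x = - f^`()%classic (- x).
Proof.
move=> df.
have dN : is_derive x (1 : R) (-%R : R -> R) (-1).
  by have := @is_deriveN _ _ _ id x 1 1 (is_derive_id _ _).
have df' : is_derive (- x) 1 f (f^`()%classic (- x)).
  by rewrite derive1E; exact/derivableP.
case: (@is_derive1_comp _ f (-%R) x _ _ df' dN) => dD D.
by split=> //; rewrite derive1E -mulrN1; exact: D.
Qed.

Section loss.
Context (R : realType) (u : R -> R) (k K : R).
Hypotheses (u_cont : continuous u) (u_ge0 : forall x, 0 <= u x).
Hypothesis u_eq0 : forall x, 0 <= x -> u x = 0.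
Hypothesis u_decr : {in `]-oo, 0] &, {homo u : x y /~ x < y}}.
Hypotheses (k0 : 0 < k) (K0 : 0 < K).
Hypothesis u_deriv : forall x, x < 0 ->
  derivable u x 1 /\ k <= `|u^`()%classic x| <= K.

(** The reflected loss utility satisfies the hypotheses on a gain utility, so the gain lemmas
    transfer. *)
Let v x := u (- x).

Let v_cont : continuous v.
Proof. by move=> x; apply: continuous_comp; [exact: opp_continuous|exact: u_cont]. Qed.

Let v_ge0 x : 0 <= v x. Proof. exact: u_ge0. Qed.

Let v_eq0 x : x <= 0 -> v x = 0.
Proof. by move=> x0; rewrite /v u_eq0// oppr_ge0. Qed.

Let v_incr : {in `[0, +oo[ &, {homo v : x y / x < y}}.
Proof.
move=> x y; rewrite !in_itv/= !andbT => x0 y0 xy.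
by apply: u_decr; rewrite ?in_itv/= ?oppr_le0// ltrN2.
Qed.

Let v_deriv x : 0 < x -> derivable v x 1 /\ k <= `|v^`()%classic x| <= K.
Proof.
move=> x0; have [] := u_deriv (x := - x); first by rewrite oppr_lt0.
by move=> /is_derive_reflect[dv ->]; rewrite normrN.
Qed.

Lemma loss_lipschitz x y : `|u x - u y| <= K * `|x - y|.
Proof.
have := gain_lipschitz v_cont v_ge0 v_eq0 v_incr K0 v_deriv (- x) (- y).
by rewrite /v/= !opprK [- x + y]addrC [`|y - x|]distrC.
Qed.

Lemma loss_level x z : 0 <= z -> z < u x -> x < - (z / K).
Proof.
move=> z0 zx; rewrite ltrNr.
by apply: (gain_level v_cont v_ge0 v_eq0 v_incr K0 v_deriv z0); rewrite /v opprK.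
Qed.

Lemma loss_bounds t : 0 <= t -> k * t <= u (- t) <= K * t.
Proof. exact: (gain_bounds v_cont v_ge0 v_eq0 v_incr v_deriv). Qed.

Lemma loss_clamp t x : 0 < t ->
  u (Num.max (- t) (Num.min x t)) = Num.min (u x) (u (- t)).
Proof.
move=> t0; have := gain_clamp v_ge0 v_eq0 v_incr (- x) t0.
by rewrite /v/= -oppr_clamp// !opprK.
Qed.

End loss.

(** * Assembling gains and losses *)

(** Triangle inequality after pairing gains with gains and losses with losses; finiteness reduces
    the rearrangement to real numbers. *)
Lemma lee_abse_subACA (R : realDomainType) (A B C D X Y : \bar R) :
  A \is a fin_num -> B \is a fin_num -> C \is a fin_num -> D \is a fin_num ->
  (`|A - C| <= X -> `|B - D| <= Y -> `|(A - B) - (C - D)| <= X + Y)%E.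
Proof.
case: A => // a; case: B => // b; case: C => // c; case: D => // d _ _ _ _ hX hY.
apply: (le_trans _ (leeD hX hY)); rewrite -!EFinB/= -EFinD lee_fin.
by rewrite (_ : _ - _ = (a - c) - (b - d)) ?ler_normB//; ring.
Qed.

Lemma lebesgue_stieltjes_tail_le_ccdf (R : realType) (F : cdfun R) (u : R -> R) (x z : R) :
  measurable_fun setT u -> (forall y, z < u y -> x < y) ->
  fine (lebesgue_stieltjes_measure F [set y | z < u y]) <= 1 - F x.
Proof.
move=> mu ux.
have mA : measurable [set y | z < u y] by exact: measurable_superlevel.
rewrite -lee_fin -lebesgue_stieltjes_gt fineK; last exact: fin_num_measure.
apply: le_measure; rewrite ?inE; [exact: mA|exact: measurable_itv|].
by move=> y /= /ux; rewrite in_itv/= andbT.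
Qed.

Lemma lebesgue_stieltjes_tail_le_cdf (R : realType) (F : cdfun R) (u : R -> R) (x z : R) :
  measurable_fun setT u -> (forall y, z < u y -> y < x) ->
  fine (lebesgue_stieltjes_measure F [set y | z < u y]) <= F x.
Proof.
move=> mu ux.
have mA : measurable [set y | z < u y] by exact: measurable_superlevel.
rewrite -lee_fin -lebesgue_stieltjes_le fineK; last exact: fin_num_measure.
apply: le_measure; rewrite ?inE; [exact: mA|exact: measurable_itv|].
by move=> y /= /ux /ltW; rewrite in_itv.
Qed.

Theorem lemma16 (R : realType) (up um wp wm : R -> R)
    (Kp kp Km km alpha L : R)
    (* utilities *)
    (up_cont : continuous up) (um_cont : continuous um)
    (up_ge0 : forall x : R, 0 <= up x) (um_ge0 : forall x : R, 0 <= um x)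
    (up_eq0 : forall x : R, x <= 0 -> up x = 0)
    (um_eq0 : forall x : R, 0 <= x -> um x = 0)
    (up_incr : {in `[0, +oo[ &, {homo up : x y / x < y}})
    (um_decr : {in `]-oo, 0] &, {homo um : x y /~ x < y}})
    (Kp_gt0 : 0 < Kp) (kp_gt0 : 0 < kp) (Km_gt0 : 0 < Km) (km_gt0 : 0 < km)
    (up_deriv : forall x : R, 0 < x ->
       derivable up x 1 /\ kp <= `|up^`()%classic x| <= Kp)
    (um_deriv : forall x : R, x < 0 ->
       derivable um x 1 /\ km <= `|um^`()%classic x| <= Km)
    (* weights *)
    (wp_itv : {homo wp : p / p \in `[0, 1]})
    (wm_itv : {homo wm : p / p \in `[0, 1]})
    (wp_cont : {within `[0, 1], continuous wp})
    (wm_cont : {within `[0, 1], continuous wm})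
    (wp_nd : {in `[0, 1] &, {homo wp : p q / p <= q}})
    (wm_nd : {in `[0, 1] &, {homo wm : p q / p <= q}})
    (wp0 : wp 0 = 0) (wm0 : wm 0 = 0) (wp1 : wp 1 = 1) (wm1 : wm 1 = 1)
    (alpha_gt0 : 0 < alpha) (alpha_le1 : alpha <= 1) (L_gt0 : 0 < L)
    (wp_holder : {in `[0, 1] &, forall p q,
       `|wp p - wp q| <= L * `|p - q| `^ alpha})
    (wm_holder : {in `[0, 1] &, forall p q,
       `|wm p - wm q| <= L * `|p - q| `^ alpha})
    (F G : cdfun R)
    (F_fin : cpt up um wp wm F \is a fin_num)
    (tau : R) (tau_gt0 : 0 < tau) :
  (`|cpt up um wp wm F - cpt up um wp wm (trunc_cdf tau G)|
   <= (L * (Kp + Km))%:E * wasserstein1 F G `^ alpha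
        * (tau `^ (1 - alpha))%:E
      + (L * Kp)%:E * \int[lebesgue_measure]_(z in `[(kp / Kp * tau)%R, +oo[)
          ((1 - F z) `^ alpha)%:E
      + (L * Km)%:E * \int[lebesgue_measure]_(z in `]-oo, (- (km / Km * tau))%R])
          ((F z) `^ alpha)%:E)%E.
Proof.
have mup : measurable_fun setT up by exact: continuous_measurable_fun.
have mum : measurable_fun setT um by exact: continuous_measurable_fun.
have mF : measurable_fun setT F.
  by apply: nondecreasing_measurable => // x y; exact: cumulative_is_nondecreasing.
have mS (c : R) : measurable_fun setT (fun z => F (c * z)).
  by apply: measurableT_comp => //; exact: measurable_funM.
have /andP[kbp bKp] := gain_bounds up_cont up_ge0 up_eq0 up_incr up_deriv (ltW tau_gt0).
have /andP[kbm bKm] := loss_bounds um_cont um_ge0 um_eq0 um_decr um_deriv (ltW tau_gt0).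
(* A finite difference forces both integrals to be finite, as each one-sided bound requires. *)
move: F_fin; rewrite /cpt /cptX fin_numB => /andP[Ap_fin Am_fin].
have [] := @truncation_bound R up wp (fun z => 1 - F (Kp^-1 * z)) Kp kp L alpha tau
  (up tau) F G Kp_gt0 kp_gt0 L_gt0 tau_gt0 alpha_gt0 alpha_le1 mup
  (gain_lipschitz up_cont up_ge0 up_eq0 up_incr Kp_gt0 up_deriv) kbp bKp
  (fun x => gain_clamp up_ge0 up_eq0 up_incr x tau_gt0) wp_nd wp0 wp_holder.
- exact: measurable_funB.
- move=> z z0; apply: lebesgue_stieltjes_tail_le_ccdf => // x zx.
  rewrite mulrC.
  exact: (gain_level up_cont up_ge0 up_eq0 up_incr Kp_gt0 up_deriv z0 zx).
- exact: Ap_fin.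
move=> Cp_fin boundp.
have [] := @truncation_bound R um wm (fun z => F (- Km^-1 * z)) Km km L alpha tau
  (um (- tau)) F G Km_gt0 km_gt0 L_gt0 tau_gt0 alpha_gt0 alpha_le1 mum
  (loss_lipschitz um_cont um_ge0 um_eq0 um_decr Km_gt0 um_deriv) kbm bKm
  (fun x => loss_clamp um_ge0 um_eq0 um_decr x tau_gt0) wm_nd wm0 wm_holder.
- exact: mS.
- move=> z z0; apply: lebesgue_stieltjes_tail_le_cdf => // x zx.
  rewrite mulNr mulrC.
  exact: (loss_level um_cont um_ge0 um_eq0 um_decr Km_gt0 um_deriv z0 zx).
- exact: Am_fin.
move=> Cm_fin boundm.
apply: (le_trans (@lee_abse_subACA _ _ _ _ _ _ _ Ap_fin Am_fin Cp_fin Cm_fin boundp boundm)).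
(* Substituting [z = Kp * x] carries the start [kp * tau] to [kp / Kp * tau] and yields the factor
   [Kp]. *)
have Ip : (\int[lebesgue_measure]_(z in `[(kp * tau)%R, +oo[) ((1 - F (Kp^-1 * z)) `^ alpha)%:E
  = Kp%:E * \int[lebesgue_measure]_(z in `[(kp / Kp * tau)%R, +oo[) ((1 - F z) `^ alpha)%:E)%E.
  have -> : `[kp * tau, +oo[%classic = [set z | `[kp / Kp * tau, +oo[%classic (Kp^-1 * z)].
    apply/seteqP; split => z /=; rewrite !in_itv/= !andbT;
      by rewrite mulrAC [kp * tau / Kp]mulrC ler_pM2l// invr_gt0.
  rewrite (@ge0_integral_scale _ Kp^-1 _ (fun x => ((1 - F x) `^ alpha)%:E)).
  - by rewrite gtr0_norm ?invr_gt0// invrK.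
  - by rewrite invr_eq0 gt_eqF.
  - exact: measurable_itv.
  - apply/measurable_EFinP; apply: measurable_funTS.
    apply: (@measurableT_comp _ _ _ _ _ _ (@powR R ^~ alpha)) => //.
    exact: measurable_funB.
  - by move=> x _; rewrite lee_fin powR_ge0.
(* The negative scale [- Km^-1] turns an upper half-line of levels into a lower half-line of
   outcomes. *)
have Im : (\int[lebesgue_measure]_(z in `[(km * tau)%R, +oo[) ((F (- Km^-1 * z)) `^ alpha)%:E
  = Km%:E * \int[lebesgue_measure]_(z in `]-oo, (- (km / Km * tau))%R]) ((F z) `^ alpha)%:E)%E.
  have -> : `[km * tau, +oo[%classic = [set z | `]-oo, - (km / Km * tau)]%classic (- Km^-1 * z)].
    apply/seteqP; split => z /=; rewrite !in_itv/= !andbT;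
      by rewrite mulNr lerN2 mulrAC [km * tau / Km]mulrC ler_pM2l// invr_gt0.
  rewrite (@ge0_integral_scale _ (- Km^-1) _ (fun x => ((F x) `^ alpha)%:E)).
  - by rewrite normrN gtr0_norm ?invr_gt0// invrK.
  - by rewrite oppr_eq0 invr_eq0 gt_eqF.
  - exact: measurable_itv.
  - apply/measurable_EFinP; apply: measurable_funTS.
    exact: (@measurableT_comp _ _ _ _ _ _ (@powR R ^~ alpha)).
  - by move=> x _; rewrite lee_fin powR_ge0.
rewrite Ip Im mulrDr EFinD !muleA -!EFinM.
(* With nonnegative coefficients the sum [L * Kp + L * Km] distributes even when [wasserstein1 F G]
   is infinite. *)
have LKp : 0 <= L * Kp by rewrite mulr_ge0// ltW.
have LKm : 0 <= L * Km by rewrite mulr_ge0// ltW.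
rewrite ge0_muleDl ?lee_fin// ge0_muleDl ?mule_ge0 ?lee_fin ?poweR_ge0//.
by rewrite addeACA addeA.
Qed.
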